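(* Let $2^{\mathbb{N}}$ denote the Cantor set. If $\mathbb{F}$ is a countable free group, then the set of topological $\mathbb{F}$-systems $\mathbb{F}\curvearrowright^a 2^{\mathbb{N}}$ with sofic entropy at most $0$, i.e. such that $h^{\mathrm{tp}}_\Sigma(\mathbb{F}\curvearrowright^a 2^{\mathbb{N}})\le 0$ for every sofic approximation $\Sigma$ to $\mathbb{F}$, is comeager in $\mathrm{A}_{\mathrm{top}}(\mathbb{F},2^{\mathbb{N}})$.
   Context: For a countable discrete group $\Gamma$, a topological $\Gamma$-system $\Gamma \curvearrowright^a X$ consists of a compact metrizable space $X$ and a homomorphism $a:\Gamma\to \mathrm{Homeo}(X)$, where $\mathrm{Homeo}(X)$ is the group of homeomorphisms of $X$; write $\gamma^a$ for $a(\gamma)$. $\mathrm{A}_{\mathrm{top}}(\Gamma,X)$ is the Polish space of all topological $\Gamma$-systems with phase space $X$, where $a_n\to a$ if and only if for every $\gamma\in\Gamma$ the homeomorphisms $\gamma^{a_n}$ converge uniformly to $\gamma^a$. Sofic approximations. Let $[n]=\{1,\dots,n\}$, let $u_n$ be the uniform probability measure on $[n]$ and $\mathrm{Sym}(n)$ the symmetric group of $[n]$. For a function $\sigma:\Gamma\to\mathrm{Sym}(n)$ write $\gamma^\sigma m=\sigma(\gamma)(m)$. A sofic approximation to $\Gamma$ is a sequence $\Sigma=(\sigma_i)_{i=1}^\infty$ of functions (not necessarily homomorphisms) $\sigma_i:\Gamma\to\mathrm{Sym}(n_i)$ with $n_i\to\infty$ such that for all $\gamma_1,\gamma_2\in\Gamma$,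 $\lim_{i\to\infty} u_{n_i}(\{m\in[n_i]:(\gamma_1\gamma_2)^{\sigma_i}m=\gamma_1^{\sigma_i}\gamma_2^{\sigma_i}m\})=1$, and for all $\gamma_1\neq\gamma_2$ in $\Gamma$, $\lim_{i\to\infty} u_{n_i}(\{m\in[n_i]:\gamma_1^{\sigma_i}m\neq\gamma_2^{\sigma_i}m\})=1$. Topological sofic entropy. Fix a compatible metric $d$ on $X$. For maps $\phi,\psi:[n]\to X$ put $d^2(\phi,\psi)=\left(\frac1n\sum_{m=1}^n d(\phi(m),\psi(m))^2\right)^{1/2}$ and $d^\infty(\phi,\psi)=\max_{m\in[n]}d(\phi(m),\psi(m))$. For finite $F\subseteq\Gamma$, $\delta>0$ and $\sigma:\Gamma\to\mathrm{Sym}(n)$, $\mathrm{Map}(\sigma,F,\delta)$ is the set of $\phi:[n]\to X$ with $d^2(\phi\circ\gamma^\sigma,\gamma^a\circ\phi)\le\delta$ for all $\gamma\in F$. For a metric space $(Y,\rho)$, $\mathrm{Sep}(Y,\epsilon,\rho)$ is the maximal cardinality of a set $S\subseteq Y$ with $\rho(y_1,y_2)\ge\epsilon$ for all distinct $y_1,y_2\in S$. With $\log 0=-\infty$, define $$h^{\mathrm{tp}}_\Sigma(\delta,F,\epsilon)=\limsup_{i\to\infty}\frac1{n_i}\log \mathrm{Sep}(\mathrm{Map}(\sigma_i,F,\delta),\epsilon,d^\infty),$$ $h^{\mathrm{tp}}_\Sigma(F,\epsilon)=\inf_{\delta>0}h^{\mathrm{tp}}_\Sigma(\delta,F,\epsilon)$,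 $h^{\mathrm{tp}}_\Sigma(\epsilon)=\inf_F h^{\mathrm{tp}}_\Sigma(F,\epsilon)$ (over nonempty finite $F\subseteq\Gamma$), and $h^{\mathrm{tp}}_\Sigma(\Gamma\curvearrowright^a X)=\sup_{\epsilon>0}h^{\mathrm{tp}}_\Sigma(\epsilon)$.
   Formalization: The free group is assumed nontrivial: for the trivial group the space of systems is a single point, whose entropy is positive for σ_i(1) = id, so the claim fails there; every rank from 1 to countably infinite is covered. *)

(* Defs.v *)
From HB Require Import structures.
From mathcomp Require Import all_boot all_order all_fingroup all_algebra.
From mathcomp Require Import all_classical all_reals all_analysis.

Set Implicit Arguments.
Unset Strict Implicit.
Unset Printing Implicit Defensive.

Import Order.TTheory GRing.Theory Num.Theory.
Import numFieldNormedType.Exports.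

Local Open Scope classical_set_scope.
Local Open Scope ring_scope.

(* [G] is free on [S]: every map from [S] to a group extends uniquely to a     *)
(* homomorphism. A map from [S] is represented by a function on all of [G],    *)
(* of which only the values on [S] are used.                                   *)
Definition free_on (G : groupType) (S : set G) : Prop :=
  forall (H : groupType) (f : G -> H),
    exists2 phi : {multiplicative G -> H},
      forall s, S s -> phi s = f s &
      forall psi : {multiplicative G -> H},
        (forall s, S s -> psi s = f s) -> psi =1 phi.

Definition free_group (G : groupType) : Prop := exists S : set G, free_on S.

Definition homeomorphism (X Y : topologicalType) (f : X -> Y) : Prop :=
  continuous f /\ exists g : Y -> X, [/\ continuous g, cancel f g & cancel g f].

Record homeo (X : topologicalType) : Type := Homeo {
  homeo_fun :> X -> X;
  homeoP : homeomorphism homeo_fun }.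

Section HomeoGroup.
Context (X : topologicalType).
Implicit Types f g h : homeo X.

Lemma homeo_ext f g : homeo_fun f =1 homeo_fun g -> f = g.
Proof.
case: f g => f Pf [g Pg] /= /funext fg; move: Pf; rewrite fg => Pf.
by congr Homeo; exact: Prop_irrelevance.
Qed.

Lemma homeo_id_subproof : homeomorphism (@idfun X).
Proof. by split; [move=> x|exists idfun; split => // x]; exact: cvg_id. Qed.

Definition homeo_one : homeo X := Homeo homeo_id_subproof.

Lemma homeo_mul_subproof f g : homeomorphism (f \o g).
Proof.
case: f g => f [cf [f' [cf' fK f'K]]] [g [cg [g' [cg' gK g'K]]]] /=.
split; first by move=> x; apply: continuous_comp; [exact: cg|exact: cf].
exists (g' \o f'); split.
- by move=> x; apply: continuous_comp; [exact: cf'|exact: cg'].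
- by move=> x /=; rewrite fK gK.
- by move=> x /=; rewrite g'K f'K.
Qed.

Definition homeo_mul f g : homeo X := Homeo (homeo_mul_subproof f g).

Lemma homeo_inv_subproof f :
  {g : homeo X | cancel f g & cancel g f}.
Proof.
apply: cid2; case: f => f [cf [g [cg fK gK]]] /=.
have Pg : homeomorphism g by split => //; exists f.
by exists (Homeo Pg).
Qed.

Definition homeo_inv f : homeo X := s2val (homeo_inv_subproof f).

HB.instance Definition _ := gen_eqMixin (homeo X).
HB.instance Definition _ := gen_choiceMixin (homeo X).

Lemma homeo_mulA : associative homeo_mul.
Proof. by move=> f g h; exact: homeo_ext. Qed.

Lemma homeo_mul1g : left_id homeo_one homeo_mul.
Proof. by move=> f; exact: homeo_ext. Qed.

Lemma homeo_mulg1 : right_id homeo_one homeo_mul.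
Proof. by move=> f; exact: homeo_ext. Qed.

Lemma homeo_mulVg : left_inverse homeo_one homeo_inv homeo_mul.
Proof.
by move=> f; apply: homeo_ext => x /=; exact: (s2valP (homeo_inv_subproof f)).
Qed.

Lemma homeo_mulgV : right_inverse homeo_one homeo_inv homeo_mul.
Proof.
by move=> f; apply: homeo_ext => x /=; exact: (s2valP' (homeo_inv_subproof f)).
Qed.

HB.instance Definition _ := isGroup.Build (homeo X)
  homeo_mulA homeo_mul1g homeo_mulg1 homeo_mulVg homeo_mulgV.

End HomeoGroup.

Definition top_system (G : groupType) (X : topologicalType) : Type :=
  {multiplicative G -> homeo X}.

HB.instance Definition _ G X := gen_eqMixin (top_system G X).
HB.instance Definition _ G X := gen_choiceMixin (top_system G X).

Definition system_fun (G : groupType) (X : topologicalType)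
    (a : top_system G X) (g : G) : X -> X :=
  homeo_fun (Multiplicative.sort a g).

(* The coarsest topology making each [a |-> system_fun a g] continuous for     *)
(* uniform convergence. On a compact Hausdorff [X] the uniform structure is    *)
(* the only compatible one, so it agrees with that of any compatible metric.   *)
Definition A_top (G : groupType) (X : uniformType) : Type :=
  initial_topology
    (@system_fun G X : top_system G X -> {ptws G -> {uniform X -> X}}).

HB.instance Definition _ G X := Topological.on (A_top G X).

Definition comeager (T : topologicalType) (A : set T) : Prop :=
  exists2 U : (set T)^nat,
    forall k, open (U k) /\ dense (U k) & \bigcap_k U k `<=` A.

Definition compatible_metric (R : realType) (X : topologicalType)
    (d : X -> X -> R) : Prop :=
  [/\ forall x y, 0 <= d x y,
      forall x y, d x y = 0 <-> x = y,
      forall x y, d x y = d y x,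
      forall x y z, d x z <= d x y + d y z &
      forall x (A : set X),
        nbhs x A <-> exists2 e : R, 0 < e & [set y | d x y < e] `<=` A].

Record sofic_approximation (R : realType) (G : groupType) : Type := {
  sofic_deg : nat -> nat;
  sofic_map : forall i, G -> 'S_(sofic_deg i);
  sofic_deg_gt0 : forall i, (0 < sofic_deg i)%N;
  sofic_deg_cvg : sofic_deg i @[i --> \oo] --> \oo;
  sofic_mul : forall g1 g2 : G,
    (#|[set m | sofic_map i (g1 * g2)%g m
                == sofic_map i g1 (sofic_map i g2 m)]%SET|%:R
      / (sofic_deg i)%:R : R) @[i --> \oo] --> (1 : R);
  sofic_free : forall g1 g2 : G, g1 <> g2 ->
    (#|[set m | sofic_map i g1 m != sofic_map i g2 m]%SET|%:R
      / (sofic_deg i)%:R : R) @[i --> \oo] --> (1 : R) }.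

Definition dist2 (R : realType) (X : Type) (d : X -> X -> R) (n : nat)
    (phi psi : 'I_n -> X) : R :=
  Num.sqrt (n%:R^-1 * \sum_(m < n) d (phi m) (psi m) ^+ 2).

Definition distoo (R : realType) (X : Type) (d : X -> X -> R) (n : nat)
    (phi psi : 'I_n -> X) : R :=
  \big[Num.max/0]_(m < n) d (phi m) (psi m).

Definition Map (R : realType) (G : groupType) (X : topologicalType)
    (d : X -> X -> R) (a : top_system G X) (n : nat) (sigma : G -> 'S_n)
    (F : set G) (delta : R) : set ('I_n -> X) :=
  [set phi : 'I_n -> X | forall g, F g ->
     dist2 d (phi \o sigma g) (system_fun a g \o phi) <= delta].

(* Extended-real valued: [+oo] when there are separated sets of every finite   *)
(* size.                                                                       *)
Definition Sep (R : realType) (T : Type) (Y : set T) (eps : R)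
    (rho : T -> T -> R) : \bar R :=
  ereal_sup [set (k%:R : R)%:E | k in
    [set k : nat | exists S : set T,
      [/\ S `<=` Y, (S #= `I_k)%card &
          forall y1 y2, S y1 -> S y2 -> y1 <> y2 -> eps <= rho y1 y2]]].

Section Entropy.
Context (R : realType) (G : groupType) (X : topologicalType).
Context (d : X -> X -> R) (Sigma : sofic_approximation R G).
Context (a : top_system G X).
Local Open Scope ereal_scope.

(* [lne 0 = -oo] *)
Definition entropy_delta (delta : R) (F : set G) (eps : R) : \bar R :=
  limn_esup (fun i =>
    ((sofic_deg Sigma i)%:R^-1)%:E *
    lne (Sep (Map d a (@sofic_map R G Sigma i) F delta) eps
             (@distoo R X d (sofic_deg Sigma i)))).

Definition entropy_fin (F : set G) (eps : R) : \bar R :=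
  ereal_inf [set entropy_delta delta F eps | delta in [set t : R | (0 < t)%R]].

Definition entropy_eps (eps : R) : \bar R :=
  ereal_inf [set entropy_fin F eps |
    F in [set F : set G | finite_set F /\ F !=set0]].

Definition sofic_entropy : \bar R :=
  ereal_sup [set entropy_eps eps | eps in [set t : R | (0 < t)%R]].

End Entropy.

(* Main.v *)
(* A free generator [s] has infinite order, so the permutations of a sofic     *)
(* approximation that represent it have few cycles, and it suffices to control *)
(* the single homeomorphism given by [s]. Call a homeomorphism [T] good at     *)
(* scale [M] if there is a clopen set [r] with [T r] in [r] such that inside   *)
(* [r] the first [M] digits of [T x] are a function of those of [x], and, when *)
(* [T x] is not in [r], the first [M] digits of [x] are a function of those of *)
(* [T x].                                                                      *)
(* This is an open condition. It is dense: given [T], cut the clopen sets on   *)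
(* which the words of [x] and [T x] are prescribed into nonempty clopen pieces *)
(* and map them homeomorphically onto pieces arranged so that every word has   *)
(* exactly one successor inside [r] and one predecessor outside [r]. For a     *)
(* good [T], an approximate microstate is determined by its values at the few  *)
(* points where the itinerary breaks, at the transitions into [r] (no more     *)
(* than the breaks, since a permutation enters a set as often as it leaves     *)
(* it) and at one point of each cycle; such data are subexponential in number. *)
From HB Require Import structures.
Require Import Defs.
From mathcomp Require Import all_boot all_order all_fingroup all_algebra.
From mathcomp Require Import all_classical all_reals all_analysis.
From mathcomp Require Import ring lra.

Set Implicit Arguments.
Unset Strict Implicit.
Unset Printing Implicit Defensive.

Import Order.TTheory GRing.Theory Num.Theory.
Import numFieldNormedType.Exports.

Local Open Scope classical_set_scope.
Local Open Scope ring_scope.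

(** * Clopen partitions of the Cantor set *)

(** The dense $G_\delta$ is the intersection over $N$ of the sets [trapping_systems s N], for one
    free generator $s$, which exists as the group is nontrivial. [dense_trapping] perturbs the
    single homeomorphism at $s$; freeness lets the other generators keep theirs
    ([perturb_generator]).

    The entropy is bounded with $F=\{s\}$. The name of a microstate $\phi$ records the word and the
    [r]-value of each $\phi(m)$, and microstates with equal names are $d^\infty$-close. By
    [name_code_inj] a name is recovered from its restriction to at most $4|B|+|A|$ points, where $B$
    is the set of bad points and $A$ a transversal of the cycles. [card_bad] makes $B$ sparse; $A$
    is sparse because $s^k\neq 1$ for $k>0$ makes short cycles rare ([negligible_short_cycles],
    [cycle_transversal]). [card_small_support] then bounds the number of such partial names by
    $e^{cn}$ with $c>0$ arbitrary. *)

Definition agree (M : nat) (x y : cantor_space) := forall i, (i < M)%N -> x i = y i.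

Definition finitely_determined (K : Type) (f : cantor_space -> K) :=
  exists M, forall x y, agree M x y -> f x = f y.

(** Uniform continuity written on digits, so that gluing constructions need no topology;
    [continuous_ucontinuous] identifies it with continuity. *)
Definition ucontinuous (f : cantor_space -> cantor_space) :=
  forall M, exists L, forall x y, agree L x y -> agree M (f x) (f y).

Definition word (M : nat) (x : cantor_space) : {ffun 'I_M -> bool} :=
  [ffun i : 'I_M => x i].

Definition ccons (b : bool) (x : cantor_space) : cantor_space :=
  fun i => if i is j.+1 then x j else b.

Definition ctail (x : cantor_space) : cantor_space := fun i => x i.+1.

Lemma agree_refl M x : agree M x x. Proof. by []. Qed.

Lemma agree_sym M x y : agree M x y -> agree M y x.
Proof. by move=> xy i iM; rewrite xy. Qed.

Lemma agree_trans M x y z : agree M x y -> agree M y z -> agree M x z.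
Proof. by move=> xy yz i iM; rewrite xy // yz. Qed.

Lemma agree_le M L x y : (M <= L)%N -> agree L x y -> agree M x y.
Proof. by move=> ML xy i iM; apply: xy; exact: leq_trans iM ML. Qed.

Lemma wordP M x y : word M x = word M y <-> agree M x y.
Proof.
split=> [/ffunP xy i iM|xy]; first by have := xy (Ordinal iM); rewrite !ffunE.
by apply/ffunP => i; rewrite !ffunE; exact: xy.
Qed.

Lemma word_surj M (w : {ffun 'I_M -> bool}) : exists x, word M x = w.
Proof.
exists (fun i => if insub i is Some j then w j else false).
by apply/ffunP => i; rewrite ffunE valK.
Qed.

Lemma ccons_tail x : ccons (x 0%N) (ctail x) = x.
Proof. by apply/funext => -[]. Qed.

Lemma agree_ccons M b x y : agree M x y -> agree M.+1 (ccons b x) (ccons b y).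
Proof. by move=> xy [|i] //= iM; exact: xy. Qed.

Lemma agree_tail M x y : agree M.+1 x y -> agree M (ctail x) (ctail y).
Proof. by move=> xy i iM; exact: xy. Qed.

Lemma finitely_determined_word M : finitely_determined (word M).
Proof. by exists M => x y /wordP. Qed.

Lemma finitely_determined_comp (K : Type) (f : cantor_space -> K) g :
  finitely_determined f -> ucontinuous g -> finitely_determined (f \o g).
Proof.
move=> [M fM] /(_ M) [L gL]; exists L => x y /gL; exact: fM.
Qed.

Lemma finitely_determined_post (K K' : Type) (h : K -> K') f :
  finitely_determined f -> finitely_determined (h \o f).
Proof. by move=> [M fM]; exists M => x y /fM /= ->. Qed.

Lemma finitely_determined_pair (K K' : Type) (f : cantor_space -> K)
    (g : cantor_space -> K') :
  finitely_determined f -> finitely_determined g ->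
  finitely_determined (fun x => (f x, g x)).
Proof.
move=> [M fM] [L gL]; exists (maxn M L) => x y xy.
by rewrite (fM x y) ?(gL x y) //; apply: agree_le xy; rewrite ?leq_maxl ?leq_maxr.
Qed.

Lemma uniform_bound (K : finType) (P : K -> nat -> Prop) :
  (forall k m n, (m <= n)%N -> P k m -> P k n) ->
  (forall k, exists n, P k n) -> exists n, forall k, P k n.
Proof.
move=> mono /choice [L PL]; exists (\max_k L k) => k.
by apply: mono (PL k); exact: leq_bigmax.
Qed.

Lemma ucontinuous_glue (K : finType) (a : cantor_space -> K)
    (h : K -> cantor_space -> cantor_space) :
  finitely_determined a -> (forall k, ucontinuous (h k)) ->
  ucontinuous (fun x => h (a x) x).
Proof.
move=> [M aM] hk N.
have [|k|L hL] := @uniform_bound K (fun k L =>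
    forall x y, agree L x y -> agree N (h k x) (h k y)).
- by move=> k m n mn P x y xy; apply: P; exact: agree_le xy.
- exact: hk.
exists (maxn M L) => x y xy; rewrite (aM x y); last first.
  by apply: agree_le xy; exact: leq_maxl.
by apply: hL; apply: agree_le xy; exact: leq_maxr.
Qed.

Lemma finitely_determined_glue (K : finType) (K' : Type) (a : cantor_space -> K)
    (h : K -> cantor_space -> K') :
  finitely_determined a -> (forall k, finitely_determined (h k)) ->
  finitely_determined (fun x => h (a x) x).
Proof.
move=> [M aM] hk.
have [|k|L hL] := @uniform_bound K (fun k L =>
    forall x y, agree L x y -> h k x = h k y).
- by move=> k m n mn P x y xy; apply: P; exact: agree_le xy.
- exact: hk.
exists (maxn M L) => x y xy; rewrite (aM x y); last first.
  by apply: agree_le xy; exact: leq_maxl.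
by apply: hL; apply: agree_le xy; exact: leq_maxr.
Qed.

Lemma ucontinuous_comp f g : ucontinuous f -> ucontinuous g -> ucontinuous (f \o g).
Proof.
move=> uf ug M; have [L fL] := uf M; have [N gN] := ug L.
by exists N => x y /gN/fL.
Qed.

Lemma ucontinuous_id : ucontinuous id.
Proof. by move=> M; exists M. Qed.

Lemma ucontinuous_ccons b : ucontinuous (ccons b).
Proof. by move=> M; exists M => x y xy; apply: (@agree_le _ M.+1) => //; exact: agree_ccons. Qed.

Lemma ucontinuous_tail : ucontinuous ctail.
Proof. by move=> M; exists M.+1 => x y; exact: agree_tail. Qed.

Lemma finitely_determined_head : finitely_determined (fun x : cantor_space => x 0%N).
Proof. by exists 1%N => x y; exact. Qed.

(** Induction on the number of digits: the halves given by the first digit are parametrized by the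
    induction hypothesis and joined along that digit; if only one half meets [P], its digit is
    prepended. Thus a nonempty clopen set is a copy of the Cantor set. *)
Lemma clopen_param n (P : cantor_space -> Prop) :
    (forall x y, agree n x y -> P x -> P y) -> (exists x, P x) ->
  exists fg : (cantor_space -> cantor_space) * (cantor_space -> cantor_space),
    [/\ ucontinuous fg.1, ucontinuous fg.2, forall z, P (fg.1 z),
        cancel fg.1 fg.2 & forall x, P x -> fg.1 (fg.2 x) = x].
Proof.
elim: n P => [|n IH] P Pn [x0 Px0].
  by exists (id, id); split=> //= [||z]; [exact: ucontinuous_id..|exact: Pn Px0].
have half b : (exists x, P (ccons b x)) -> _ :=
  IH (fun x => P (ccons b x)) (fun x y xy => Pn _ _ (agree_ccons b xy)).
have one b : (exists x, P (ccons b x)) -> ~ (exists x, P (ccons (~~ b) x)) ->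
  exists fg : (cantor_space -> cantor_space) * (cantor_space -> cantor_space),
    [/\ ucontinuous fg.1, ucontinuous fg.2, forall z, P (fg.1 z),
        cancel fg.1 fg.2 & forall x, P x -> fg.1 (fg.2 x) = x].
  move=> /half [[f g] /= [uf ug Pf gf fg]] nb.
  exists (ccons b \o f, g \o ctail); split => //=.
  - exact/ucontinuous_comp/uf/ucontinuous_ccons.
  - exact/ucontinuous_comp/ucontinuous_tail.
  - move=> x Px; have xb : x 0%N = b.
      apply/eqP; rewrite -[_ == _]negbK; apply/negP => xb; apply: nb.
      exists (ctail x); suff <- : x 0%N = ~~ b by rewrite ccons_tail.
      by move: xb; generalize b (x 0%N) => -[] [].
    by rewrite fg -xb ccons_tail.
have [P1|P1] := pselect (exists x, P (ccons true x)); last first.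
  apply: (one false); last exact: P1.
  exists (ctail x0); move: (Px0); rewrite -{1}(ccons_tail x0).
  by case: (x0 0%N) => // Ptx; exfalso; apply: P1; exists (ctail x0).
have [P0|P0] := pselect (exists x, P (ccons false x)); last exact: (one true).
have [[f1 g1] /= [uf1 ug1 Pf1 gf1 fg1]] := half true P1.
have [[f0 g0] /= [uf0 ug0 Pf0 gf0 fg0]] := half false P0.
pose f (b : bool) := if b then f1 else f0.
pose g (b : bool) := if b then g1 else g0.
have uh (h : bool -> cantor_space -> cantor_space) : (forall b, ucontinuous (h b)) ->
    ucontinuous (fun x => ccons (x 0%N) (h (x 0%N) (ctail x))).
  move=> hu; apply: (ucontinuous_glue (h := fun b x => ccons b (h b (ctail x)))).
    exact: finitely_determined_head.
  move=> b; apply: (@ucontinuous_comp (ccons b)); first exact: ucontinuous_ccons.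
  by apply: (@ucontinuous_comp (h b)); [exact: hu|exact: ucontinuous_tail].
exists (fun x => ccons (x 0%N) (f (x 0%N) (ctail x)),
        fun x => ccons (x 0%N) (g (x 0%N) (ctail x))); split => /=.
- by apply: uh => -[].
- by apply: uh => -[].
- by move=> z; case: (z 0%N).
- move=> z /=; rewrite -[RHS](ccons_tail z); congr ccons.
  by case: (z 0%N); [exact: gf1|exact: gf0].
- move=> x Px; rewrite -[RHS](ccons_tail x); congr ccons.
  move: Px; rewrite -{1}(ccons_tail x).
  by case: (x 0%N) => Px; [exact: fg1|exact: fg0].
Qed.

Lemma fiber_param (K : Type) (c : cantor_space -> K) : finitely_determined c ->
  exists f g : K -> cantor_space -> cantor_space,
    [/\ forall k, ucontinuous (f k), forall k, ucontinuous (g k),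
        forall k z, (exists x, c x = k) -> c (f k z) = k,
        forall k z, (exists x, c x = k) -> g k (f k z) = z &
        forall k x, c x = k -> f k (g k x) = x].
Proof.
move=> [n cn].
have : forall k, exists fg : (cantor_space -> cantor_space) * (cantor_space -> cantor_space),
    [/\ ucontinuous fg.1, ucontinuous fg.2 &
      (exists x, c x = k) ->
      [/\ forall z, c (fg.1 z) = k, cancel fg.1 fg.2 &
          forall x, c x = k -> fg.1 (fg.2 x) = x]].
  move=> k; have [ck|nck] := pselect (exists x, c x = k); last first.
    (* An empty fibre receives a dummy parametrization. *)
    by exists (id, id); split => //; exact: ucontinuous_id.
  have [|fg [uf ug Pf gf fgK]] := @clopen_param n (fun x => c x = k) _ ck.
    by move=> x y /cn ->.
  by exists fg; split.
move=> /choice [fg fgP]; exists (fun k => (fg k).1), (fun k => (fg k).2).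
split=> k; have [uf ug fgk] := fgP k => //.
- by move=> z /fgk [].
- by move=> z /fgk [_ +]; exact.
- by move=> x cx; have [|_ _] := fgk; [exists x|exact].
Qed.

(** Each fibre of [a] goes to the fibre of [b] with the same label, through the Cantor set that
    parametrizes both; equality of the label sets ensures that neither is empty when the other is
    not. *)
Lemma glue_homeo (K : finType) (a b : cantor_space -> K) :
    finitely_determined a -> finitely_determined b ->
    (forall k, (exists x, a x = k) <-> (exists y, b y = k)) ->
  exists h k : cantor_space -> cantor_space,
    [/\ ucontinuous h, ucontinuous k, cancel h k, cancel k h &
        forall x, b (h x) = a x].
Proof.
move=> da db ab.
have [fa [ga [ufa uga afa gfa fga]]] := fiber_param da.
have [fb [gb [ufb ugb bfb gfb fgb]]] := fiber_param db.
have ax x : exists y, b y = a x by apply/ab; exists x.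
have bx y : exists x, a x = b y by apply/ab; exists y.
exists (fun x => fb (a x) (ga (a x) x)), (fun y => fa (b y) (gb (b y) y)); split.
- apply: (@ucontinuous_glue _ a (fun k => fb k \o ga k)) => // k.
  exact: ucontinuous_comp.
- apply: (@ucontinuous_glue _ b (fun k => fa k \o gb k)) => // k.
  exact: ucontinuous_comp.
- by move=> x /=; rewrite bfb // gfb // fga.
- by move=> y /=; rewrite afa // gfa // fgb.
- by move=> x; rewrite bfb.
Qed.

(** The label is read off the position of the first digit [true] among the first [size s]; if there
    is none, [nth] falls back on the head. *)
Lemma finite_surjection (K : eqType) (s : seq K) : s != [::] ->
  exists c : cantor_space -> K, [/\ finitely_determined c, forall x, c x \in s &
    forall k, k \in s -> exists x, c x = k].
Proof.
case: s => // k0 s _; set t := k0 :: s.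
exists (fun x => nth k0 t (find x (iota 0 (size t)))); split.
- exists (size t) => x y xy; congr nth; apply: eq_in_find => i.
  by rewrite mem_iota => /andP[_]; exact: xy.
- move=> x; set j := find _ _; have [jt|jt] := ltnP j (size t).
    exact: mem_nth.
  by rewrite nth_default ?mem_head.
- move=> k kt; exists (fun i => i == index k t); rewrite -[RHS](nth_index k0 kt).
  congr nth; move: kt; rewrite -index_mem.
  move: (index k t) (size t) => j n jn.
  rewrite (_ : iota 0 n = iota 0 j ++ iota j (n - j)); last first.
    by rewrite -{2}[j]add0n -iotaD subnKC // ltnW.
  rewrite find_cat ifF; last first.
    apply/negbTE/hasPn => i; rewrite mem_iota => /andP[_].
    by rewrite add0n neq_ltn => ->.
  rewrite size_iota; have -> : (n - j = (n - j).-1.+1)%N.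
    by rewrite prednK // subn_gt0.
  by rewrite /= eqxx addn0.
Qed.

(** Each nonempty cell of [c] is a Cantor set, so it can be mapped onto its finite nonempty set of
    labels allowed by [Rel]. *)
Lemma refine_labels (K1 K : finType) (c : cantor_space -> K1) (Rel : K1 -> K -> Prop) :
    finitely_determined c -> (forall x, exists k, Rel (c x) k) ->
  exists e : cantor_space -> K, [/\ finitely_determined e,
    forall x, Rel (c x) (e x) &
    forall x k, Rel (c x) k -> exists x', c x' = c x /\ e x' = k].
Proof.
move=> dc cR.
have [f [g [uf ug cf gf fg]]] := fiber_param dc.
have [k0 _] := cR (fun=> false).
have : forall k1, exists h : cantor_space -> K, finitely_determined h /\
    ((exists x, c x = k1) -> (forall x, Rel k1 (h x)) /\
       forall k, Rel k1 k -> exists x, h x = k).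
  move=> k1; have [[x cx]|nk1] := pselect (exists x, c x = k1); last first.
    by exists (fun=> k0); split=> //; exists 0%N.
  have [|h [dh hR Rh]] := @finite_surjection K (enum [set k | `[<Rel k1 k>]]%SET).
    have [k] := cR x; rewrite cx => /asboolP Rk; apply/negP => /eqP e0.
    by have : k \in enum [set k | `[<Rel k1 k>]]%SET; [rewrite mem_enum inE|rewrite e0].
  exists h; split => // _; split.
    by move=> z; have := hR z; rewrite mem_enum inE => /asboolP.
  by move=> k /asboolP Rk; apply: Rh; rewrite mem_enum inE.
move=> /choice [h hP]; exists (fun x => h (c x) (g (c x) x)); split.
- apply: (@finitely_determined_glue _ _ c (fun k => h k \o g k)) => // k.
  by apply: finitely_determined_comp => //; exact: (hP k).1.
- by move=> x; have [_ [|+ _]] := hP (c x); [exists x|exact].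
- move=> x k Rk; have [_ [|_ /(_ _ Rk) [z hz]]] := hP (c x); first by exists x.
  by exists (f (c x) z); rewrite cf ?gf //; exists x.
Qed.

(* Inside the trapping region [r] an itinerary is determined by its first      *)
(* letter, outside it by its last letter.                                      *)
Definition trapping (M : nat) (T : cantor_space -> cantor_space)
    (r : cantor_space -> bool)
    (nxt prv : {ffun 'I_M -> bool} -> {ffun 'I_M -> bool}) :=
  forall x, (r x -> r (T x) /\ word M (T x) = nxt (word M x)) /\
            (~~ r (T x) -> word M x = prv (word M (T x))).

(** Sources [x] are labelled with an edge type [t x], targets [y] with a predecessor word and an
    edge type. As every cell carries all its allowed labels, the data [al] of sources and [be] of
    targets take the same values, and [glue_homeo] gives a [T'] matching them. It moves words as [T]
    does, while the types force [nxt] inside [r] and [prv] outside. *)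
Lemma dense_trapping M (T Ti : cantor_space -> cantor_space) :
    ucontinuous T -> cancel T Ti -> cancel Ti T ->
  exists T' T'i : cantor_space -> cantor_space,
    [/\ ucontinuous T', ucontinuous T'i, cancel T' T'i, cancel T'i T' &
        forall x, word M (T' x) = word M (T x)] /\
    exists r nxt prv, finitely_determined r /\ @trapping M T' r nxt prv.
Proof.
move=> uT TK TiK.
pose W := {ffun 'I_M -> bool}.
pose E (i j : W) := exists x, word M x = i /\ word M (T x) = j.
have /choice [nxt nxtP] : forall i : W, exists j, E i j.
  by move=> i; have [x <-] := word_surj i; exists (word M (T x)), x.
have /choice [prv prvP] : forall j : W, exists i, E i j.
  move=> j; have [y <-] := word_surj j; exists (word M (Ti y)), (Ti y).
  by rewrite TiK.
(* edge types: [None] enters the trapping region, [Some true] stays inside it,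
   [Some false] stays outside *)
pose ok (e : W * W) (t : option bool) :=
  match t with None => True | Some true => e.2 = nxt e.1 | Some false => e.1 = prv e.2 end.
have dWT : finitely_determined (fun x => (word M x, word M (T x))).
  apply: finitely_determined_pair; first exact: finitely_determined_word.
  exact: (finitely_determined_comp (finitely_determined_word M)).
have [|t [dt tok okt]] := @refine_labels _ _ _ ok dWT.
  by move=> x; exists None.
pose r x := t x == Some true.
have dr : finitely_determined r.
  exact: (@finitely_determined_post _ _ (fun u => u == Some true)).
(* Both sides of [r] meet every word: [None] is allowed on every edge, and [Some true] on the edge
   from [j] to [nxt j]. *)
have rsurj j rho : exists x, word M x = j /\ r x = rho.
  case: rho.
    have [x [xj Tx]] := nxtP j.
    have [|x' [[e1 e2] tx']] := okt x (Some true); first by rewrite /= xj Tx.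
    by exists x'; rewrite e1 xj /r tx'.
  have [x [xj Tx]] := nxtP j; have [|x' [[e1 e2] tx']] := okt x None => //.
  by exists x'; rewrite e1 xj /r tx'.
(* The last clause says that exactly the edges of type [Some false] end outside [r]. *)
pose Rel (jr : W * bool) (it : W * option bool) :=
  [/\ E it.1 jr.1, ok (it.1, jr.1) it.2 & jr.2 = (it.2 != Some false)].
have dWr : finitely_determined (fun y => (word M y, r y)).
  exact: (finitely_determined_pair (finitely_determined_word M)).
have [|e [de eR Re]] := @refine_labels _ _ _ Rel dWr.
  move=> y; case: (boolP (r y)) => ry.
    by exists (prv (word M y), None); split=> //=; exact: prvP.
  by exists (prv (word M y), Some false); split=> //=; exact: prvP.
pose al x := (word M x, word M (T x), t x).
pose be y := ((e y).1, word M y, (e y).2).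
have [|||T' [T'i [uT' uT'i T'K T'iK bea]]] := @glue_homeo _ al be.
- exact: (finitely_determined_pair dWT).
- apply: finitely_determined_pair.
    apply: finitely_determined_pair; last exact: finitely_determined_word.
    exact: (@finitely_determined_post _ _ fst).
  exact: (@finitely_determined_post _ _ snd).
- move=> [[i j] u]; split=> [[x [<- <- <-]]|[y [<- <- <-]]].
    have [y [wy ry]] := rsurj (word M (T x)) (t x != Some false).
    have [|y' [[wy' ry'] ey']] := Re y (word M x, t x).
      by split => //=; [exists x; rewrite wy|rewrite wy; exact: tok].
    by exists y'; rewrite /be ey' wy' wy.
  have [[x [xe Txe]] /= oke _] := eR y.
  have [|x' [[xx' Tx'] tx']] := okt x (e y).2; first by rewrite xe Txe.
  by exists x'; rewrite /al xx' Tx' tx' xe Txe.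
exists T', T'i; split.
  by split => // x; have [_ ->] := bea x.
exists r, nxt, prv; split=> // x.
have [e1 w' e2] := bea x; have [_ _ /= rT'] := eR (T' x).
rewrite rT' e2 w'; split.
  by move=> /eqP tx; have := tok x; rewrite tx /=.
by rewrite negbK => /eqP tx; have := tok x; rewrite tx /=.
Qed.

(** * Topology of the Cantor set and of the space of systems *)

Lemma nbhs_agreeP (x : cantor_space) (A : set cantor_space) :
  nbhs x A <-> exists M, agree M x `<=` A.
Proof.
split=> [xA|[M MA]].
  apply: contrapT => nM.
  (* Counterexamples agreeing with [x] on longer and longer prefixes would converge to [x]. *)
  have /choice [g gP] : forall M, exists y, agree M x y /\ ~ A y.
    move=> M; apply: contrapT => ny; apply: nM; exists M => y xy.
    by apply: contrapT => nAy; apply: ny; exists y.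
  have gx : g @ \oo --> x.
    apply/cvg_sup => i U [V] [[W] oW <-] Wxi WU.
    apply: (filterS WU); rewrite nbhs_simpl; exists i.+1 => // k /= ik.
    by rewrite -((gP k).1 i).
  have [M _ /(_ M (leqnn M))] := gx _ xA.
  exact: (gP M).2.
apply: filterS MA _; elim: M => [|M IH]; first exact: filterS filterT.
have xM : nbhs x (fun y => x M = y M).
  apply: (@proj_continuous _ (fun=> bool) M x [set b | x M = b]).
  by rewrite nbhs_principalE.
apply: filterS2 IH xM => y xy xyM i; rewrite ltnS leq_eqVlt => /predU1P[->//|].
exact: xy.
Qed.

(** A Lebesgue number for the cover, with cylinders in place of balls. *)
Lemma agree_lebesgue (U : cantor_space -> set cantor_space) :
  (forall x, nbhs x (U x)) ->
  exists M, forall x, exists z, agree M x `<=` U z.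
Proof.
move=> xU; have := iffLR (compact_near_coveringP _) cantor_space_compact.
move=> /(_ nat \oo (fun M x => exists z, agree M x `<=` U z)) cov.
have [x _|M _ MP] := cov _; last first.
  by exists M => x; exact: (MP M (leqnn M)).
have /nbhs_agreeP [M MU] := xU x.
exists (agree M x, [set N | (M <= N)%N]) => /=.
  by split; [apply/nbhs_agreeP; exists M|exists M].
move=> [x' N] /= [xx' MN]; exists x => y /(agree_le MN) x'y; apply: MU.
exact: agree_trans x'y.
Qed.

(** Compactness upgrades neighbourhoods to entourages in both directions. Uniform closeness of maps
    thereby becomes agreement of digits. *)
Lemma entourage_agreeP (E : set (cantor_space * cantor_space)) :
  entourage E <-> exists M, forall x y, agree M x y -> E (x, y).
Proof.
split=> [entE|[M ME]].
  have [|M MP] := @agree_lebesgue (fun x =>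
      xsection (split_ent E) x `&` [set y | split_ent E (y, x)]).
    move=> x; apply: filterI; first exact: nbhs_entourage.
    have -> : [set y | split_ent E (y, x)] = xsection ((split_ent E)^-1)%relation x.
      by apply/seteqP; split=> y /=; rewrite /xsection /= inE.
    by apply: nbhs_entourage; exact: entourage_inv.
  exists M => x y xy; have [z zP] := MP x.
  have [_ xz] := zP x (agree_refl _); have [/xsectionP zy _] := zP y xy.
  exact: (entourage_split z entE xz zy).
suff : \forall V \near powerset_filter_from (@entourage cantor_space),
    [set: cantor_space] `<=` (fun x => forall y, V (x, y) -> agree M x y).
  case=> S [Sent _ [V SV]] SP; apply: filterS (Sent _ SV) => -[x y] /= Vxy.
  exact/ME/(SP _ SV).
have := iffLR (compact_near_coveringP _) cantor_space_compact; apply.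
move=> x _; have : nbhs x (agree M x) by apply/nbhs_agreeP; exists M.
rewrite -nbhs_entourageE => -[V entV VM].
exists (xsection (split_ent V) x, [set V' | V' `<=` split_ent V]) => /=.
  split; first exact: nbhs_entourage.
  exact: small_set_sub (entourage_split_ent entV).
move=> [x' V'] /= [/xsectionP Vxx' V'V] y V'x'y.
apply: (@agree_trans _ _ x); first apply/agree_sym/VM/xsectionP.
  exact: (split_ent_subset entV).
apply/VM/xsectionP; apply: (entourage_split x' entV Vxx'); exact: V'V.
Qed.

Lemma continuous_ucontinuous (f : cantor_space -> cantor_space) :
  continuous f <-> ucontinuous f.
Proof.
split=> [cf M|uf x A /nbhs_agreeP [M MA]]; last first.
  have [L LM] := uf M; apply/nbhs_agreeP; exists L => y xy.
  exact/MA/LM.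
have [|L LP] := @agree_lebesgue (fun x => [set y | agree M (f x) (f y)]).
  by move=> x; apply: (cf x); apply/nbhs_agreeP; exists M.
exists L => x y xy; have [z zP] := LP x.
by apply: agree_trans (agree_sym _) (zP y xy); exact: zP (agree_refl _).
Qed.

Lemma nbhs_uniform_agreeP (f : {uniform cantor_space -> cantor_space})
    (P : set {uniform cantor_space -> cantor_space}) :
  nbhs f P <-> exists M, [set h | forall x, agree M (f x) (h x)] `<=` P.
Proof.
split=> [/uniform_nbhs [E [/entourage_agreeP [M ME] EP]]|[M MP]].
  by exists M => h fh; apply: EP => x _; exact/ME.
apply/uniform_nbhs; exists [set xy | agree M xy.1 xy.2]; split.
  by apply/entourage_agreeP; exists M.
by move=> h fh; apply: MP => x; exact: fh.
Qed.

Section Metric.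
Context (R : realType) (d : cantor_space -> cantor_space -> R).
Context (dm : compatible_metric d).

Lemma agree_dist_lt (e : R) : 0 < e ->
  exists M, forall x y, agree M x y -> d x y < e.
Proof.
have [d0 _ dC dD dn] := dm => e0.
have [|M MP] := @agree_lebesgue (fun x => [set y | d x y < e / 2]).
  by move=> x; apply/dn; exists (e / 2) => //; rewrite divr_gt0.
exists M => x y xy; have [z zP] := MP x.
apply: le_lt_trans (dD _ z _) _; rewrite [ltRHS]splitr dC.
by apply: ltrD; [exact: zP (agree_refl _)|exact: zP].
Qed.

Lemma dist_lt_agree M : exists2 e : R, 0 < e & forall x y, d x y < e -> agree M x y.
Proof.
have [d0 _ dC dD dn] := dm.
have /choice [r rP] : forall x, exists e : R, 0 < e /\ forall y, d x y < e -> agree M x y.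
  move=> x; have : nbhs x (agree M x) by apply/nbhs_agreeP; exists M.
  by move=> /dn [e e0 eM]; exists e.
have [|L LP] := @agree_lebesgue (fun x => [set y | d x y < r x / 2]).
  by move=> x; apply/dn; exists (r x / 2) => //; rewrite divr_gt0 ?(rP x).1.
(* One centre per word of length [L] leaves finitely many radii, hence a positive minimum. *)
have /choice [z zP] : forall w : {ffun 'I_L -> bool}, exists z,
    forall y, word L y = w -> d z y < r z / 2.
  move=> w; have [x xw] := word_surj w; have [z zP] := LP x.
  by exists z => y yw; apply: zP; apply/wordP; rewrite xw yw.
pose e := \big[Num.min/1]_w (r (z w) / 2).
exists e => [|x y xy].
  by apply/bigmin_gtP; split => // w _; rewrite divr_gt0 ?(rP _).1.
set w := word L x; have zx := zP w x erefl.
have er : e <= r (z w) / 2 by exact: bigmin_le_cond.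
have zy : d (z w) y < r (z w).
  by apply: le_lt_trans (dD _ x _) _; rewrite [ltRHS]splitr ltrD // (lt_le_trans xy).
apply: agree_trans (agree_sym _) ((rP (z w)).2 y zy).
apply: (rP (z w)).2; apply: lt_trans zx _.
by rewrite gtr_pMr ?(rP _).1 // invf_lt1 // ltr1n.
Qed.

End Metric.

Lemma cvg_A_top (G : groupType) (b : nat -> A_top G cantor_space)
    (a : A_top G cantor_space) :
  (forall g M, \forall n \near \oo, forall x,
    agree M (system_fun a g x) (system_fun (b n) g x)) ->
  b @ \oo --> a.
Proof.
move=> ba O [_ [[B oB <-] Ba BO]].
apply: filterS BO _; have := open_nbhs_nbhs (conj oB Ba); move: B {oB Ba}.
suff : (@system_fun G cantor_space \o b :
      nat -> {ptws G -> {uniform cantor_space -> cantor_space}}) @ \oo -->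
    (@system_fun G cantor_space a :
      {ptws G -> {uniform cantor_space -> cantor_space}}) by [].
apply/cvg_sup => g U [V] [[W] oW <-] Wg WU; apply: (filterS WU); rewrite nbhs_simpl.
have /nbhs_uniform_agreeP [M MW] := open_nbhs_nbhs (conj oW Wg).
by apply: filterS (ba g M) => n bn; apply: MW.
Qed.

Lemma nbhs_system_fun (G : groupType) (a : A_top G cantor_space) g M :
  \forall b \near a, forall x, agree M (system_fun a g x) (system_fun b g x).
Proof.
have c1 := @initial_continuous _ _
  (@system_fun G cantor_space : top_system G cantor_space ->
     {ptws G -> {uniform cantor_space -> cantor_space}}) a.
have c2 := @proj_continuous {classic G}
  (fun=> {uniform cantor_space -> cantor_space}) g (system_fun a).
apply: (c1 (@^~ g @^-1` [set h | forall x, agree M (system_fun a g x) (h x)])).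
apply: c2; by apply/nbhs_uniform_agreeP; exists M.
Qed.

(** * Counting names along a permutation *)

Lemma porbit_stable (M : finType) (s : {perm M}) (D : {set M}) m t :
  (forall m, m \in D -> s m \in D) -> m \in D -> t \in porbit s m -> t \in D.
Proof.
move=> sD mD /porbitP [k ->]; elim: k => [|k IH]; first by rewrite expg0 perm1.
by rewrite expgSr permM; exact: sD.
Qed.

Definition short_cycle_points (M : finType) (s : {perm M}) (L : nat) : {set M} :=
  [set m | [exists k : 'I_L, (0 < k)%N && ((s ^+ k)%g m == m)]]%SET.

(** A representative outside the short cycles has [L] distinct iterates, and different
    representatives lie on disjoint cycles; so the long cycles contribute at most [#|M|] to
    [L * #|A|]. *)
Lemma cycle_transversal (M : finType) (s : {perm M}) : exists A : {set M},
  (forall m, exists2 t, t \in A & t \in porbit s m) /\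
  forall L, (L * #|A| <= #|M| + L * #|short_cycle_points s L|)%N.
Proof.
pose rep x := odflt x [pick y in porbit s x].
have repE x : rep x \in porbit s x.
  by rewrite /rep; case: pickP => //= /(_ x); rewrite porbit_id.
have rep_eq x y : porbit s x = porbit s y -> rep x = rep y.
  rewrite /rep => ->; case: pickP => //= /(_ y); by rewrite porbit_id.
pose A := [set x | rep x == x]%SET; exists A; split.
  move=> m; exists (rep m) => //; rewrite inE; apply/eqP/rep_eq.
  by apply/eqP; rewrite eq_sym eq_porbit_mem porbit_sym.
move=> L; set Sh := short_cycle_points s L.
have le1 : (#|A| <= #|A :\: Sh| + #|Sh|)%N.
  by rewrite -(cardsID Sh A) addnC leq_add2l subset_leq_card // subsetIr.
apply: leq_trans (leq_mul (leqnn L) le1) _; rewrite mulnDr leq_add2r.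
pose f (p : 'I_L * M) := (s ^+ p.1)%g p.2.
have : {in finset.setX (finset.setT : {set 'I_L}) (A :\: Sh) &, injective f}.
  move=> [k t] [k' t']; rewrite !inE /= /f /=.
  move=> /andP[tSh /eqP tA] /andP[_ /eqP tA'] e.
  have tt' : t = t'.
    rewrite -tA -tA'; apply: rep_eq.
    have : (s ^+ k)%g t \in porbit s t' by rewrite e mem_porbit.
    have : (s ^+ k)%g t \in porbit s t by rewrite mem_porbit.
    by rewrite -!eq_porbit_mem => /eqP <- /eqP <-.
  rewrite -{}tt' in e *; congr pair; move: e tSh; clear.
  wlog kk' : k k' / (k <= k')%N.
    move=> H e tSh; case/orP: (leq_total k k') => kk'; first exact: H.
    by rewrite (H k' k).
  move=> e; apply: contraNeq => nkk'; apply/existsP.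
  have lt : (k < k')%N by rewrite ltn_neqAle nkk'.
  have ltL : (k' - k < L)%N by apply: leq_ltn_trans (ltn_ord k'); exact: leq_subr.
  exists (Ordinal ltL) => /=; rewrite subn_gt0 lt /=.
  apply/eqP; apply: (@perm_inj _ (s ^+ k)%g).
  by rewrite -permM -expgD subnK.
move=> /card_in_imset; rewrite cardsX cardsT card_ord => <-.
exact: max_card.
Qed.

Section Names.
Context (M : finType) (W : eqType) (s : {perm M}) (nxt prv : W -> W).

Implicit Types (q : M -> W * bool).

Definition legal (u v : W * bool) : Prop :=
  (u.2 -> v.2 /\ v.1 = nxt u.1) /\ (~~ v.2 -> u.1 = prv v.1).

(* A legal edge is regular unless it enters the trapping region. *)
Definition irregular q : {set M} :=
  [set m | ~~ [&& (q m).2 == (q (s m)).2,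
                  (q m).2 ==> ((q (s m)).1 == nxt (q m).1) &
                  ~~ (q m).2 ==> ((q m).1 == prv (q (s m)).1)]]%SET.

(* As [s] is a permutation, the trapping region is entered as often as it is   *)
(* left, and leaving it is not legal.                                          *)
Lemma card_irregular q (B : {set M}) :
  (forall m, m \notin B -> legal (q m) (q (s m))) ->
  (#|irregular q| <= 2 * #|B|)%N.
Proof.
move=> qB.
pose up := [set m | ~~ (q m).2 && (q (s m)).2]%SET.
pose dn := [set m | (q m).2 && ~~ (q (s m)).2]%SET.
have dnB : dn \subset B.
  apply/fintype.subsetP => m; rewrite inE => /andP[qm qsm].
  by apply/negPn/negP => /qB [/(_ qm) [qsm' _] _]; rewrite qsm' in qsm.
have updn : #|up| = #|dn|.
  pose R := [set m | (q m).2]%SET; pose sR := [set m | (q (s m)).2]%SET.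
  have cR : #|sR| = #|R|.
    rewrite -(card_preimset R (@perm_inj _ s)); apply: eq_card => m.
    by rewrite !inE.
  have <- : sR :\: R = up by apply/setP => m; rewrite !inE.
  have <- : R :\: sR = dn by apply/setP => m; rewrite !inE andbC.
  by apply/eqP; rewrite -(eqn_add2l #|R :&: sR|) cardsID finset.setIC cardsID cR.
have : irregular q \subset B :|: up.
  apply/fintype.subsetP => m; rewrite !inE; apply: contraR.
  rewrite negb_or => /andP[/qB [l1 l2]].
  case: (boolP (q m).2) l1 => qm.
    by move=> /(_ isT) [-> ->]; rewrite !eqxx.
  by move=> _ /= nq; rewrite (negbTE nq) /= (l2 nq).
move=> /subset_leq_card /leq_trans; apply.
apply: leq_trans (leq_card_setU _ _) _; rewrite mulSn mul1n leq_add2l updn.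
exact: subset_leq_card.
Qed.

(** The image of the irregular points is included because, inside the trapping region, the word at
    [m] is computed from the one at its predecessor, which must be regular. *)
Definition name_support (A : {set M}) q : {set M} :=
  irregular q :|: (s @: irregular q) :|: A.

Definition name_code (A : {set M}) q : {ffun M -> option (W * bool)} :=
  [ffun m => if m \in name_support A q then Some (q m) else None].

(** Where two names with the same code differ, both are regular, so the difference spreads along the
    cycle: forward for the [r]-value, then backward for words inside the region (through [nxt]) and
    forward for words outside (through [prv]). It would reach a point of [A], where the code records
    the name. *)
Lemma name_code_inj (A : {set M}) q q' :
    (forall m, exists2 t, t \in A & t \in porbit s m) ->
  name_code A q = name_code A q' -> q =1 q'.
Proof.
move=> tA /ffunP qq'.
have same m : q m != q' m -> m \notin name_support A q /\ m \notin name_support A q'.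
  move: (qq' m); rewrite !ffunE; case: ifP; case: ifP => //.
  by move=> _ _ [->]; rewrite eqxx.
have vanish (r : {perm M}) (D : {set M}) : porbit r =1 porbit s ->
    (forall m, m \in D -> q m != q' m) -> (forall m, m \in D -> r m \in D) ->
    forall m, m \notin D.
  move=> rs Dq rD m; apply/negP => mD; have [t tAt] := tA m.
  rewrite -rs => /(porbit_stable rD mD)/Dq/same [].
  by rewrite !inE tAt orbT.
have reg q0 m : m \notin name_support A q0 -> m \notin irregular q0.
  by apply: contra; rewrite !inE => ->.
have regV q0 m : m \notin name_support A q0 -> (s^-1)%g m \notin irregular q0.
  apply: contra => mi; rewrite finset.in_setU finset.in_setU -{2}(permKV s m).
  by rewrite imset_f ?orbT.
have rho m : (q m).2 = (q' m).2.
  apply/eqP; have := @vanish s [set m | (q m).2 != (q' m).2]%SET.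
  move=> /(_ (fun=> erefl)) van.
  have {van} : m \notin [set m | (q m).2 != (q' m).2]%SET.
    apply: van => {}m; rewrite !inE; first by apply: contra => /eqP ->.
    move=> qm; have [|/reg m1 /reg m2] := same m.
      by apply: contra qm => /eqP ->.
    move: m1 m2; rewrite !inE !negbK => /andP[/eqP <- _] /andP[/eqP <- _].
    exact: qm.
  by rewrite inE negbK.
have inside m : m \notin [set m | (q m).2 && ((q m).1 != (q' m).1)]%SET.
  apply: (@vanish (s^-1)%g) => {m} [m|m|m]; first exact: porbitV.
    by rewrite inE => /andP[_]; apply: contra => /eqP ->.
  rewrite inE => /andP[qm w]; have [|/regV m1 /regV m2] := same m.
    by apply: contra w => /eqP ->.
  move: m1 m2; rewrite !inE !negbK !permKV => /and3P[/eqP e1 e2 _] /and3P[/eqP e1' e2' _].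
  rewrite e1 qm /=; move: e2 e2'; rewrite e1 e1' -rho qm /= => /eqP e2 /eqP e2'.
  by apply: contra w => /eqP e; rewrite e2 e2' e.
have outside m : m \notin [set m | ~~ (q m).2 && ((q m).1 != (q' m).1)]%SET.
  apply: (@vanish s) => {m} [//|m|m].
    by rewrite inE => /andP[_]; apply: contra => /eqP ->.
  rewrite inE => /andP[qm w]; have [|/reg m1 /reg m2] := same m.
    by apply: contra w => /eqP ->.
  move: m1 m2; rewrite !inE !negbK => /and3P[/eqP e1 _ e2] /and3P[/eqP e1' _ e2'].
  rewrite -e1 qm /=; move: e2 e2'; rewrite -rho qm /= => /eqP e2 /eqP e2'.
  by apply: contra w => /eqP e; rewrite e2 e2' e.
move=> m; rewrite [LHS]surjective_pairing [RHS]surjective_pairing -rho; congr pair.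
move: (inside m) (outside m); rewrite !inE.
by case: ((q m).2) => //= ; rewrite ?negbK => ? ?; apply/eqP.
Qed.

End Names.

(** Generating function bound: give each recorded letter the weight [t]. The total weight of all
    codes is the right-hand side, and a code with at most [K] letters weighs at least [t ^+ K] since
    [t <= 1]. *)
Lemma card_small_support (R : realType) (M V : finType) (t : R) (K : nat) :
  0 < t -> t <= 1 ->
  #|[set c : {ffun M -> option V} | #|[set m | c m != None]%SET| <= K]%SET|%N%:R
    * t ^+ K <= (1 + t * #|V|%:R) ^+ #|M|.
Proof.
move=> t0 t1; pose wt (u : option V) : R := if u is Some _ then t else 1.
have wt0 u : 0 <= wt u by case: u => [v|]; rewrite /wt ?ltW ?ltr01.
have -> : (1 + t * #|V|%:R) ^+ #|M| = \sum_(c : {ffun M -> option V}) \prod_m wt (c m).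
  rewrite -(bigA_distr_bigA (fun (_ : M) u => wt u)) /= prodr_const.
  congr (_ ^+ _).
  rewrite (bigD1 None) //=; congr (_ + _).
  rewrite (reindex_omap Some id) /=; last by case.
  rewrite (eq_bigl xpredT); last by move=> v; rewrite eqxx.
  by rewrite sumr_const mulr_natr.
set C := [set c | _]%SET.
rewrite (bigID (fun c => c \in C)) /= -[leLHS]addr0 lerD //; last first.
  by apply: sumr_ge0 => c _; exact: prodr_ge0.
rewrite -mulr_natl mulr1 mulr_natl -sumr_const.
apply: ler_sum => c; rewrite inE => cK.
rewrite (bigID (fun m => c m != None)) /= [X in _ * X]big1 ?mulr1; last first.
  by move=> m /negPn/eqP ->.
rewrite (eq_bigr (fun=> t)); last by move=> m; case: (c m).
rewrite prodr_const; apply: le_trans (ler_wiXn2l (ltW t0) t1 cK) _.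
by rewrite le_eqVlt; apply/orP; left; apply/eqP; congr (_ ^+ _);
  apply: eq_card => m; rewrite !inE.
Qed.

(** * Free generators *)

Section Homomorphisms.
Context (G H : groupType) (f : {multiplicative G -> H}).

Lemma hom1 : f 1%g = 1%g.
Proof. by apply: (mulgI (f 1%g)); rewrite -gmulfM !mulg1. Qed.

Lemma homV g : f (g^-1)%g = ((f g)^-1)%g.
Proof. by apply: (mulgI (f g)); rewrite -gmulfM !mulgV hom1. Qed.

Lemma hom_expg g n : f (g ^+ n)%g = (f g ^+ n)%g.
Proof. by elim: n => [|n IH]; rewrite ?hom1 // !expgS gmulfM IH. Qed.

End Homomorphisms.

Section FreeGenerators.
Context (G : groupType) (S : set G) (free_S : free_on S).

(** [P] defines a subgroup containing [S]. Extend the inclusion of [S] to a homomorphism into it;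
    composed with the embedding it is the identity by uniqueness, so the subgroup is everything. *)
Lemma free_on_ind (P : G -> Prop) :
    P 1%g -> (forall g h, P g -> P h -> P (g * h)%g) -> (forall g, P g -> P (g^-1)%g) ->
  (forall s, S s -> P s) -> forall g, P g.
Proof.
move=> P1 PM PV PS.
pose p : pred G := fun g => `[<P g>].
have cp : group_closed p.
  split; first exact/asboolP.
  by move=> g h /asboolP Pg /asboolP Ph; apply/asboolP/PM => //; exact: PV.
pose H : groupType := HB.pack {g : G | p g}
  (SubChoice_isSubGroup.Build G p {g : G | p g} cp).
have vM : {morph (val : {g : G | p g} -> G) : x y / (x : H) * (y : H) >-> x * y}%g.
  by [].
pose v : {multiplicative H -> G} := HB.pack (val : H -> G)
  (isMultiplicative.Build H G (val : H -> G) vM).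
pose e (g : G) : H := if pselect (P g) is left Pg then exist _ g (introT (asboolP _) Pg)
  else 1%g.
have [phi phiE _] := free_S e.
have [psi _ uniq] := free_S (idfun : G -> G).
have vphi : (v \o phi : {multiplicative G -> G}) =1 psi.
  by apply: uniq => s Ss /=; rewrite phiE // /e; case: pselect => // /(_ (PS s Ss)).
have idpsi : (idfun : {multiplicative G -> G}) =1 psi by exact: uniq.
move=> g; have <- : val (phi g) = g by have /= -> := vphi g; rewrite -idpsi.
by have /asboolP := valP (phi g).
Qed.

Lemma free_on_generator : (exists g : G, g <> 1%g) -> exists s, S s.
Proof.
move=> [g g1]; apply: contrapT => nS; apply: g1.
apply: (@free_on_ind (fun g => g = 1%g)) => // [x y -> ->|x ->|s Ss].
- exact: mulg1.
- exact: invg1.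
- by exfalso; apply: nS; exists s.
Qed.

Lemma free_generator_expg s k : S s -> (0 < k)%N -> (s ^+ k)%g <> 1%g.
Proof.
case: k => // k Ss _ sk.
(* The exponent is now [k.+1], so a cyclic group of order [k.+2] detects it. *)
have [phi phiE _] := free_S (fun=> Zp1 : 'I_k.+2).
have := congr1 phi sk; rewrite hom_expg hom1 phiE // => e.
have := congr1 (@nat_of_ord _) e; rewrite Zp_expg /=.
by rewrite modn_small ?mul1n // modn_small.
Qed.

End FreeGenerators.

Lemma homeoVK (X : topologicalType) (h : homeo X) : cancel h (h^-1)%g.
Proof. by move=> x; exact: (congr1 (fun u : homeo X => u x) (mulVg h)). Qed.

Lemma homeoKV (X : topologicalType) (h : homeo X) : cancel (h^-1)%g h.
Proof. by move=> x; exact: (congr1 (fun u : homeo X => u x) (mulgV h)). Qed.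

Lemma homeo_ucontinuous (h : homeo cantor_space) : ucontinuous h.
Proof. by apply/continuous_ucontinuous; exact: (homeoP h).1. Qed.

(** Only the value at [s] is changed. The elements at which convergence holds form a subgroup
    containing [S]. *)
Lemma perturb_generator (G : groupType) (S : set G) s (a : A_top G cantor_space)
    (T : nat -> homeo cantor_space) : free_on S -> S s ->
    (forall n x, agree n (system_fun a s x) (T n x)) ->
  exists b : nat -> A_top G cantor_space,
    (forall n, Multiplicative.sort (b n) s = T n) /\ b @ \oo --> a.
Proof.
move=> free_S Ss aT.
have /choice [b bP] : forall n, exists b : top_system G cantor_space,
    forall t, S t -> b t = if t == s then T n else Multiplicative.sort a t.
  move=> n; have [b bE _] := free_S (homeo cantor_space)
    (fun t => if t == s then T n else Multiplicative.sort a t).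
  by exists b.
exists b; split; first by move=> n; rewrite bP // eqxx.
apply: cvg_A_top; apply: (free_on_ind free_S).
- move=> M; near=> n => x.
  by rewrite /system_fun !hom1.
- move=> g h ag ah M; have [L LM] := homeo_ucontinuous (Multiplicative.sort a g) M.
  apply: filterS2 (ag M) (ah L) => n agn ahn x.
  rewrite /system_fun !gmulfM /=.
  exact: agree_trans (LM _ _ (ahn x)) (agn _).
- move=> g ag M.
  have [L LM] := homeo_ucontinuous ((Multiplicative.sort a g)^-1)%g M.
  apply: filterS (ag L) => n agn x; rewrite /system_fun !homV.
  (* Evaluating at the inverse image under [b n] requires a modulus only for the fixed inverse from
     [a], uniformly in [n]. *)
  have /LM := agn (((Multiplicative.sort (b n) g)^-1)%g x).
  by rewrite /system_fun homeoVK homeoKV => /agree_sym.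
- move=> t St M; exists M => // n /= Mn x; rewrite /system_fun bP //.
  case: eqP => [->|_]; last exact: agree_refl.
  exact: agree_le Mn (aT n x).
Unshelve. all: by end_near. Qed.

(** * Sofic approximations and entropy *)

Section Sofic.
Context (R : realType) (G : groupType) (Sigma : sofic_approximation R G).

Let n i := sofic_deg Sigma i.
Let sg i g := @sofic_map R G Sigma i g.

Definition negligible_points (A : forall i, {set 'I_(n i)}) :=
  forall k : R, 0 < k -> \forall i \near \oo, #|A i|%:R <= k * (n i)%:R.

Lemma negligible_sub (A B : forall i, {set 'I_(n i)}) :
  (forall i, A i \subset B i) -> negligible_points B -> negligible_points A.
Proof.
move=> AB nB k k0; apply: filterS (nB k k0) => i; apply: le_trans.
by rewrite ler_nat subset_leq_card.
Qed.

Lemma negligible_setU (A B : forall i, {set 'I_(n i)}) :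
  negligible_points A -> negligible_points B ->
  negligible_points (fun i => A i :|: B i).
Proof.
move=> nA nB k k0; have k2 : 0 < k / 2 by rewrite divr_gt0.
apply: filterS2 (nA _ k2) (nB _ k2) => i Ai Bi.
rewrite [k]splitr mulrDl; apply: le_trans (lerD Ai Bi).
by rewrite -natrD ler_nat leq_card_setU.
Qed.

Lemma negligible_setC (A : forall i, {set 'I_(n i)}) :
  (#|A i|%:R / (n i)%:R : R) @[i --> \oo] --> (1 : R) ->
  negligible_points (fun i => ~: A i).
Proof.
move=> A1 k k0; have : 1 - k < 1 by rewrite gtrBl.
move=> /(cvgr_gt _ A1); apply: filterS => i.
have n0 : 0 < (n i)%:R :> R by rewrite ltr0n; exact: sofic_deg_gt0.
rewrite ltr_pdivlMr // mulrBl mul1r ltrBlDr => /ltW nA.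
by rewrite -(lerD2l #|A i|%:R) -natrD cardsC card_ord.
Qed.

Lemma negligible_mul g h :
  negligible_points (fun i => [set m | sg i (g * h)%g m != sg i g (sg i h m)]%SET).
Proof.
apply: negligible_sub (negligible_setC (sofic_mul Sigma g h)) => i.
by apply/fintype.subsetP => m; rewrite !inE.
Qed.

Lemma negligible_free g h : g <> h ->
  negligible_points (fun i => [set m | sg i g m == sg i h m]%SET).
Proof.
move=> gh; apply: negligible_sub (negligible_setC (sofic_free Sigma gh)) => i.
by apply/fintype.subsetP => m; rewrite !inE negbK.
Qed.

Lemma negligible_one : negligible_points (fun i => [set m | sg i 1%g m != m]%SET).
Proof.
apply: negligible_sub (negligible_mul 1 1) => i.
by apply/fintype.subsetP => m; rewrite !inE mulg1 (inj_eq perm_inj) eq_sym.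
Qed.

Lemma negligible_expg g k :
  negligible_points (fun i => [set m | sg i (g ^+ k)%g m != (sg i g ^+ k)%g m]%SET).
Proof.
elim: k => [|k IH].
  apply: negligible_sub negligible_one => i.
  by apply/fintype.subsetP => m; rewrite !inE !expg0 perm1.
apply: negligible_sub (negligible_setU (negligible_mul g (g ^+ k)) IH) => i.
apply/fintype.subsetP => m; rewrite !inE; apply: contraR.
rewrite negb_or !negbK => /andP[/eqP e /eqP e'].
by rewrite expgS e e' expgSr permM.
Qed.

(** Off negligible sets, a point fixed by the [L]-th power of the permutation of [g] is moved alike
    by the permutations of [g ^+ L] and of [1], which sofic freeness makes rare. *)
Lemma negligible_short_cycles g L : (forall k, (0 < k)%N -> (g ^+ k)%g <> 1%g) ->
  negligible_points (fun i => short_cycle_points (sg i g) L).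
Proof.
move=> g1; elim: L => [|L IH].
  move=> k k0; exists 0%N => // i _.
  have -> : short_cycle_points (sg i g) 0 = finset.set0.
    by apply/setP => m; rewrite !inE; apply/existsP => -[[]].
  by rewrite cards0 mulr_ge0 // ltW.
(* Here [g ^+ 0 = 1], so freeness says nothing, but no [k] satisfies [0 < k < 1]. *)
have [->|L0] := posnP L.
  move=> k k0; exists 0%N => // i _.
  have -> : short_cycle_points (sg i g) 1 = finset.set0.
    by apply/setP => m; rewrite !inE; apply/existsP => -[[[]]].
  by rewrite cards0 mulr_ge0 // ltW.
apply: negligible_sub (negligible_setU IH (negligible_setU negligible_one
  (negligible_setU (negligible_expg g L) (negligible_free (g1 L L0))))) => i.
apply/fintype.subsetP => m; rewrite [m \in short_cycle_points _ _]inE.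
move=> /existsP [[k kL] /= /andP[k0 /eqP km]]; rewrite finset.in_setU.
move: kL; rewrite ltnS leq_eqVlt => /predU1P[kE|kL].
  apply/orP; right; rewrite !inE; apply/negPn; rewrite !negb_or !negbK.
  apply/negP => /and3P[/eqP e1 /eqP e2]; rewrite e1 e2 -{2}km kE eqxx.
  by [].
by rewrite inE; apply/orP; left; apply/existsP; exists (Ordinal kL); rewrite /= k0 km eqxx.
Qed.

End Sofic.

Lemma limn_esup_le (R : realType) (u : (\bar R)^nat) (c : \bar R) :
  (\forall i \near \oo, (u i <= c)%E) -> (limn_esup u <= c)%E.
Proof.
move=> uc; rewrite /limn_esup limf_esupE.
apply: (@le_trans _ _ (ereal_sup (u @` [set i | (u i <= c)%E]))).
  by apply: ereal_inf_lbound; exists [set i | (u i <= c)%E].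
by apply: ge_ereal_sup => _ [i ui <-].
Qed.

Section Entropy.
Context (R : realType) (n M : nat) (T : cantor_space -> cantor_space).
Context (r : cantor_space -> bool).
Context (nxt prv : {ffun 'I_M -> bool} -> {ffun 'I_M -> bool}).
Hypothesis trap : trapping T r nxt prv.
Context (d : cantor_space -> cantor_space -> R) (delta0 : R) (d0 : 0 < delta0).
Hypothesis dist_lt_name : forall x y, d x y < delta0 ->
  word M x = word M y /\ r x = r y.

Let W := {ffun 'I_M -> bool}.
Let q (phi : 'I_n -> cantor_space) m : W * bool := (word M (phi m), r (phi m)).

(** Chebyshev's inequality: each bad point contributes at least [delta0 ^+ 2] to the sum of
    squares. *)
Lemma card_bad (s : 'S_n) (phi : 'I_n -> cantor_space) (delta : R) :
  dist2 d (phi \o s) (T \o phi) <= delta ->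
  delta0 ^+ 2 * #|[set m | q phi (s m) != q (T \o phi) m]%SET|%:R <= n%:R * delta ^+ 2.
Proof.
set B := finset _; move=> dT.
have ge0 : 0 <= n%:R^-1 * \sum_(m < n) d ((phi \o s) m) ((T \o phi) m) ^+ 2.
  by rewrite mulr_ge0 ?invr_ge0 // sumr_ge0 // => m _; exact: sqr_ge0.
have [n0|n0] := posnP n.
  have -> : #|B| = 0%N.
    by apply/eqP; rewrite -leqn0 -[leqRHS]n0 -[leqRHS]card_ord max_card.
  by rewrite mulr0 mulr_ge0 // sqr_ge0.
have : n%:R^-1 * \sum_(m < n) d ((phi \o s) m) ((T \o phi) m) ^+ 2 <= delta ^+ 2.
  rewrite -(sqr_sqrtr ge0) ler_sqr ?nnegrE ?sqrtr_ge0 //.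
  exact: le_trans (sqrtr_ge0 _) dT.
rewrite ler_pdivrMl ?ltr0n //; apply: le_trans.
rewrite mulr_natr -sumr_const big_mkcond /=; apply: ler_sum => m _.
case: ifPn => [|_]; last exact: sqr_ge0.
rewrite inE => qm; have : delta0 <= d (phi (s m)) (T (phi m)).
  rewrite leNgt; apply: contra qm => /dist_lt_name [e1 e2].
  by rewrite /q /= e1 e2.
by move=> /[dup] /(le_trans (ltW d0)) ? ?; rewrite ler_sqr ?nnegrE // ltW.
Qed.

Lemma card_name_support (s : 'S_n) (A : {set 'I_n}) (phi : 'I_n -> cantor_space) :
  (#|name_support s nxt prv A (q phi)| <=
     4 * #|[set m | q phi (s m) != q (T \o phi) m]%SET| + #|A|)%N.
Proof.
set B := finset _.
have cI : (#|irregular s nxt prv (q phi)| <= 2 * #|B|)%N.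
  apply: card_irregular => m; rewrite inE negbK => /eqP ->.
  exact: (trap (phi m)).
apply: leq_trans (leq_card_setU _ _) _; rewrite leq_add2r.
apply: leq_trans (leq_card_setU _ _) _.
(* The irregular points and their image each cost at most [2 * #|B|]. *)
rewrite (_ : 4 = 2 + 2)%N // mulnDl leq_add //.
exact: leq_trans (leq_imset_card _ _) cI.
Qed.

(** Equal codes give equal words everywhere, hence distance below [eps]; so a separated set injects
    into the codes of small support. *)
Lemma card_separated (s : 'S_n) (A : {set 'I_n}) (eps t : R) (K k : nat)
    (Y S : set ('I_n -> cantor_space)) :
    (forall m, exists2 a, a \in A & a \in porbit s m) ->
    0 < eps -> (forall x y, word M x = word M y -> d x y < eps) ->
    0 < t <= 1 -> (forall phi, Y phi ->
      4 * #|[set m | q phi (s m) != q (T \o phi) m]%SET| + #|A| <= K)%N ->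
    S `<=` Y -> (S #= `I_k)%card ->
    (forall y1 y2, S y1 -> S y2 -> y1 <> y2 -> eps <= distoo d y1 y2) ->
  k%:R * t ^+ K <= (1 + t * #|{: W * bool}|%:R) ^+ n.
Proof.
move=> tA e0 de /andP[t0 t1] YK SY /card_set_bijP [f [fS finj fsurj]] Ssep.
have /choice [h hP] : forall i : 'I_k, exists phi, S phi /\ f phi = i.
  by move=> i; have [phi Sphi fphi] := fsurj i (ltn_ord i); exists phi.
pose c (i : 'I_k) := name_code s nxt prv A (q (h i)).
have cinj : injective c.
  move=> i j /(name_code_inj tA) qij; apply: ord_inj.
  rewrite -(hP i).2 -(hP j).2; congr f; apply: contrapT => hij.
  have := Ssep _ _ (hP i).1 (hP j).1 hij; apply/negP; rewrite -ltNge.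
  apply/bigmax_ltP; split=> // m _; apply: de.
  by have [] := qij m.
have <- : #|c @: 'I_k| = k by rewrite card_imset // card_ord.
have := @card_small_support R 'I_n (W * bool)%type t K t0 t1; rewrite card_ord.
apply: le_trans; rewrite ler_wpM2r ?exprn_ge0 ?(ltW t0) // ler_nat.
apply: subset_leq_card; apply/fintype.subsetP => _ /imsetP [i _ ->].
rewrite inE; apply: leq_trans (YK _ (SY _ (hP i).1)).
apply: leq_trans (card_name_support s A (h i)).
apply: subset_leq_card; apply/fintype.subsetP => m; rewrite inE ffunE.
by case: ifP.
Qed.

End Entropy.

(** * Trapping systems *)

(** The logarithm of the count is at most $tvn+uK$ with $u=-\ln t$. The choice of [t] bounds the
    first term by $cn/2$; then [k] is chosen so that $K\le kn$ bounds the second by $cn/2$. *)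
Lemma entropy_delta_trapping_le (R : realType) (G : groupType)
    (Sigma : sofic_approximation R G) (a : top_system G cantor_space) (s : G)
    (d : cantor_space -> cantor_space -> R) (M : nat) (r : cantor_space -> bool)
    (nxt prv : {ffun 'I_M -> bool} -> {ffun 'I_M -> bool}) (eps c : R) :
    compatible_metric d -> (forall k, (0 < k)%N -> (s ^+ k)%g <> 1%g) ->
    finitely_determined r -> trapping (system_fun a s) r nxt prv ->
    0 < eps -> (forall x y, word M x = word M y -> d x y < eps) -> 0 < c ->
  exists2 delta, 0 < delta & (entropy_delta d Sigma a delta [set s] eps <= c%:E)%E.
Proof.
move=> dm s1 [Mr rMr] trap eps0 deps c0.
have [delta0 d0 dname] := dist_lt_agree dm (maxn M Mr).
have {}dname x y : d x y < delta0 -> word M x = word M y /\ r x = r y.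
  move=> /dname xy; split.
    by apply/wordP; apply: agree_le xy; exact: leq_maxl.
  by apply: rMr; apply: agree_le xy; exact: leq_maxr.
pose v : R := #|{: {ffun 'I_M -> bool} * bool}|%:R.
have v0 : 0 <= v by [].
pose t := (1 + 2 * v / c)^-1.
have vc : 0 <= 2 * v / c by rewrite divr_ge0 ?mulr_ge0 // ltW.
have t0 : 0 < t by rewrite invr_gt0; lra.
have t1 : t <= 1 by rewrite invf_le1; lra.
have tv : t * v <= c / 2.
  rewrite /t mulrC ler_pdivrMr; last by lra.
  have -> : c / 2 * (1 + 2 * v / c) = c / 2 + v by field; rewrite gt_eqF.
  by lra.
pose u := - ln t.
have u0 : 0 <= u by rewrite oppr_ge0 ln_le0.
have tu : t = expR (- u) by rewrite opprK lnK.
pose k := c / 2 / (u + 1).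
have k0 : 0 < k by rewrite !divr_gt0 //; lra.
have ku : k * u <= c / 2.
  rewrite -[leRHS](divfK (_ : u + 1 != 0)) -/k; last by rewrite gt_eqF //; lra.
  by rewrite ler_pM2l //; lra.
(* Then $|B|\le kn/8$, so $4|B|$ takes half of the budget $kn$; the other half is left for $|A|$. *)
pose delta := delta0 * Num.sqrt (k / 8).
have k8 : 0 < k / 8 by rewrite divr_gt0.
have delta_gt0 : 0 < delta by rewrite mulr_gt0 // sqrtr_gt0.
have delta2 : delta ^+ 2 = delta0 ^+ 2 * (k / 8) by rewrite exprMn sqr_sqrtr // ltW.
(* With $L>4/k$ the long cycles contribute at most $kn/4$ representatives. *)
pose L := Num.bound (4 / k).
have Lk : 4 / k < L%:R by apply: archi_boundP; rewrite divr_ge0 // ltW.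
have L0 : 0 < L%:R :> R by apply: lt_trans Lk; rewrite divr_gt0.
exists delta => //; apply: limn_esup_le.
have k4 : 0 < k / 4 by rewrite divr_gt0.
apply: filterS (negligible_short_cycles Sigma L s1 k4) => i.
set n := sofic_deg Sigma i; set sg := sofic_map Sigma i s => short.
have n0 : 0 < n%:R :> R by rewrite ltr0n; exact: sofic_deg_gt0.
have [A [tA cA]] := cycle_transversal sg.
have {}cA : #|A|%:R <= k / 2 * n%:R :> R.
  have := cA L; rewrite card_ord -(ler_nat R) natrD !natrM => LA.
  rewrite -(ler_pM2l L0); apply: le_trans LA _.
  have n1 : n%:R <= L%:R * (k / 4 * n%:R).
    rewrite mulrA ler_peMl ?(ltW n0) //; move: Lk; rewrite ltr_pdivrMr // => /ltW Lk.
    by lra.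
  have n2 : L%:R * #|short_cycle_points sg L|%:R <= L%:R * (k / 4 * n%:R).
    by rewrite ler_pM2l.
  by apply: le_trans (lerD n1 n2) _; rewrite -mulrDr ler_pM2l //; lra.
pose K := Num.trunc (k * n%:R).
have kn0 : 0 <= k * n%:R by rewrite mulr_ge0 // ltW.
have KP : K%:R <= k * n%:R by rewrite -truncn_ge_nat.
have Map_le phi : Map d a (sofic_map Sigma i) [set s] delta phi ->
    (4 * #|[set m | (word M (phi (sg m)), r (phi (sg m)))
          != (word M (system_fun a s (phi m)), r (system_fun a s (phi m)))]%SET|
      + #|A| <= K)%N.
  move=> /(_ s erefl) /(card_bad d0 dname).
  set B := finset _; rewrite delta2 => Bd.
  have {}Bd : #|B|%:R <= k / 8 * n%:R.
    rewrite -(@ler_pM2l _ (delta0 ^+ 2)) ?exprn_gt0 //.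
    by apply: le_trans Bd _; rewrite mulrA [n%:R * _]mulrC mulrAC -mulrA.
  by rewrite truncn_ge_nat // natrD natrM; lra.
have SepE : (Sep (Map d a (@sofic_map R G Sigma i) [set s] delta) eps
    (@distoo R cantor_space d n) <= (expR (c * n%:R))%:E)%E.
  apply: ge_ereal_sup => _ [j [S [SY Sj Ssep]] <-]; rewrite lee_fin.
  have t01 : 0 < t <= 1 by rewrite t0.
  have := card_separated trap tA eps0 deps t01 Map_le SY Sj Ssep.
  rewrite -/v -ler_pdivlMr ?exprn_gt0 // => /le_trans; apply.
  rewrite ler_pdivrMr ?exprn_gt0 //.
  have -> : t ^+ K = expR (- u * K%:R) by rewrite expRM_natr -tu.
  rewrite -expRD.
  apply: (@le_trans _ _ (expR (t * v * n%:R))).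
    rewrite expRM_natr lerXn2r ?nnegrE ?expR_ge0 ?expR_ge1Dx //.
    by rewrite addr_ge0 // mulr_ge0 // ltW.
  rewrite ler_expR.
  have h1 : t * v * n%:R <= c / 2 * n%:R by rewrite ler_wpM2r // ltW.
  have h2 : u * K%:R <= c / 2 * n%:R.
    apply: le_trans (ler_wpM2l u0 KP) _; rewrite mulrA [u * k]mulrC.
    by rewrite ler_wpM2r // ltW.
  by lra.
(* Monotonicity of [lne] is used on nonnegative values; the empty separated set supplies the
   bound. *)
have Sep0 : (0 <= Sep (Map d a (@sofic_map R G Sigma i) [set s] delta) eps
    (@distoo R cantor_space d n))%E.
  apply: ereal_sup_ubound; exists 0%N => //; exists set0; split=> //.
  by rewrite II0.
have lneE : (lne (Sep (Map d a (@sofic_map R G Sigma i) [set s] delta) eps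
    (@distoo R cantor_space d n)) <= (c * n%:R)%:E)%E.
  rewrite -[X in (_ <= X%:E)%E]expRK -lne_EFin ?expR_gt0 //.
  by rewrite lee_lne // in_itv /= ?Sep0 ?leey // lee_fin expR_ge0.
apply: le_trans (lee_wpmul2l _ lneE) _.
  by rewrite lee_fin invr_ge0 ltW.
by rewrite -EFinM lee_fin mulrCA mulVf ?mulr1 // gt_eqF.
Qed.

Lemma sofic_entropy_trapping_le0 (R : realType) (G : groupType)
    (Sigma : sofic_approximation R G) (a : top_system G cantor_space) (s : G)
    (d : cantor_space -> cantor_space -> R) :
    compatible_metric d -> (forall k, (0 < k)%N -> (s ^+ k)%g <> 1%g) ->
    (forall N, exists2 M, (N <= M)%N & exists r nxt prv,
      finitely_determined r /\ @trapping M (system_fun a s) r nxt prv) ->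
  (sofic_entropy d Sigma a <= 0)%E.
Proof.
move=> dm s1 trap; apply: ge_ereal_sup => _ [eps /= eps0 <-].
have [N Neps] := agree_dist_lt dm eps0.
have [M NM [r [nxt [prv [dr tr]]]]] := trap N.
apply/lee_addgt0Pr => c c0; rewrite add0e.
have [|delta delta0 dc] := entropy_delta_trapping_le Sigma dm s1 dr tr eps0 _ c0.
  by move=> x y /wordP xy; apply: Neps; exact: agree_le xy.
apply: le_trans dc; apply: (@le_trans _ _ (entropy_fin d Sigma a [set s] eps)).
  apply: ereal_inf_lbound; exists [set s] => //=; split; first exact: finite_set1.
  by exists s.
by apply: ereal_inf_lbound; exists delta.
Qed.

Section Trapping.
Context (G : groupType) (S : set G) (s : G) (free_S : free_on S) (Ss : S s).

(** The scale is only bounded below: density at precision [n] is obtained at scale [maxn n N]. *)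
Definition trapping_systems (N : nat) : set (A_top G cantor_space) :=
  [set a | exists2 M, (N <= M)%N & exists r nxt prv,
    finitely_determined r /\ @trapping M (system_fun a s) r nxt prv].

(** The condition sees the homeomorphism only through finitely many digits of its values, so the
    same [r], [nxt] and [prv] serve all nearby systems. *)
Lemma open_trapping_systems N : open (trapping_systems N).
Proof.
rewrite openE => a [M NM [r [nxt [prv [[L rL] tr]]]]].
apply: filterS (nbhs_system_fun a s (maxn M L)) => b ab.
exists M => //; exists r, nxt, prv; split; first by exists L.
move=> x; have ab' := ab x.
have <- : word M (system_fun a s x) = word M (system_fun b s x).
  by apply/wordP; apply: agree_le ab'; exact: leq_maxl.
rewrite -(rL (system_fun a s x) (system_fun b s x)) //.
by apply: agree_le ab'; exact: leq_maxr.
Qed.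

Lemma dense_trapping_systems N : dense (trapping_systems N).
Proof.
move=> O [a Oa] oO.
have /choice [T TP] : forall n, exists T : homeo cantor_space,
    (forall x, agree n (system_fun a s x) (T x)) /\
    exists2 M, (N <= M)%N & exists r nxt prv,
      finitely_determined r /\ @trapping M T r nxt prv.
  move=> n; pose h := Multiplicative.sort a s.
  have [T [Ti [[uT uTi TK TiK wT] tr]]] :=
    dense_trapping (maxn n N) (homeo_ucontinuous h) (homeoVK h) (homeoKV h).
  have hT : homeomorphism T.
    split; first exact/continuous_ucontinuous.
    by exists Ti; split=> //; exact/continuous_ucontinuous.
  exists (Homeo hT); split=> [x|]; last by exists (maxn n N) => //; exact: leq_maxr.
  have /wordP xT := wT x; apply: agree_sym; apply: agree_le xT; exact: leq_maxl.
have [b [bs ba]] := perturb_generator free_S Ss (fun n => (TP n).1).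
have [n _ /(_ n (leqnn n)) Ob] := ba _ (open_nbhs_nbhs (conj oO Oa)).
exists (b n); split=> //; have := (TP n).2; rewrite -bs; exact.
Qed.

End Trapping.

Theorem corollary1p1 (R : realType) (F : groupType)
    (free_F : free_group F) (countable_F : countable [set: F])
    (nontrivial_F : exists g : F, g <> 1%g)
    (d : cantor_space -> cantor_space -> R) (d_metric : compatible_metric d) :
  comeager [set a : A_top F cantor_space |
    forall Sigma : sofic_approximation R F,
      (sofic_entropy d Sigma a <= 0)%E].
Proof.
have [S free_S] := free_F; have [s Ss] := free_on_generator free_S nontrivial_F.
(* These sets do not depend on [Sigma], so one dense $G_\delta$ serves all sofic approximations at
   once. *)
exists (trapping_systems s) => [N|a trap Sigma].
  by split; [exact: open_trapping_systems|exact: (dense_trapping_systems free_S Ss)].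
apply: (sofic_entropy_trapping_le0 Sigma d_metric (s := s)) => [k k0|N].
  exact: (free_generator_expg free_S Ss).
exact: trap.
Qed.
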